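(* Let $0<\omega\le\pi/2$. There exists an adaptive probing strategy which, for every $n$ and every convex polygon $\mathcal{O}$ with $n$ vertices all of whose internal angles are strictly larger than $\omega$, determines $\mathcal{O}$ exactly (all its vertices) using at most $2n-2$ $\omega$-probes.
   Context: An $\omega$-wedge $\mathcal{W}(\omega,q,H_1,H_2)$ is the closed region formed by a point $q$ (the apex), two rays $H_1,H_2$ emanating from $q$ with angle $\omega$ between them such that $H_2$ is obtained from $H_1$ by a counterclockwise rotation by $\omega$, and all points between them. A valid $\omega$-probe of a convex polygon $\mathcal{O}$ with respect to a directed line $\overrightarrow{L}$ is an $\omega$-wedge containing $\mathcal{O}$, each of whose rays contains at least one point of $\mathcal{O}$, whose apex $q$ lies on $\overrightarrow{L}$, and such that the ray from $q$ in the direction of $\overrightarrow{L}$ intersects $\mathcal{O}$. Probing model: $\mathcal{O}$ is unknown to the prober, who knows only a point $p\in\mathcal{O}$ and a circle $\Psi$ with $\mathcal{O}$ contained in the disk bounded by $\Psi$ (the number $n$ of vertices is not known). One $\omega$-probe consists of the prober choosing a directed line $\overrightarrow{L}$; if a valid $\omega$-probe of $\mathcal{O}$ with respect to $\overrightarrow{L}$ exists, the prober receives its apex $q$, its rays $H_1,H_2$, and the points $p_1\in\mathcal{O}\cap H_1$, $p_2\in\mathcal{O}\cap H_2$ closest to $q$; otherwise the prober is told only that the probe missed $\mathcal{O}$. (If more than one valid probe exists, which happens only when the apex is a vertex of $\mathcal{O}$ of internal angle less than $\omega$, any one of them may be returned.) A strategy is adaptive: each chosen line may depend on all previous outcomes.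 *)

(* Defs.v *)
From Stdlib Require Import Reals Lra Lia List.
Import ListNotations.
Open Scope R_scope.

Definition point : Type := (R * R)%type.

Definition vsub (a b : point) : point := (fst a - fst b, snd a - snd b).
Definition vadd (a b : point) : point := (fst a + fst b, snd a + snd b).
Definition vscale (t : R) (a : point) : point := (t * fst a, t * snd a).
Definition dot (a b : point) : R := fst a * fst b + snd a * snd b.
Definition cross (a b : point) : R := fst a * snd b - snd a * fst b.
Definition norm (a : point) : R := sqrt (dot a a).
Definition pdist (a b : point) : R := norm (vsub a b).

Definition dir (th : R) : point := (cos th, sin th).

Definition angle (a b : point) : R := acos (dot a b / (norm a * norm b)).

(** A polygon is given by the list of its vertices in counterclockwise
    order; indices are taken cyclically. *)
Definition vtx (vs : list point) (i : nat) : point :=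
  nth (i mod length vs) vs (0, 0).

(** [vs] lists the vertices of a convex polygon with [n] vertices
    (in counterclockwise order, in strictly convex position):
    for every edge [v_i v_(i+1)], every other vertex lies strictly to its left. *)
Definition convex_polygon (n : nat) (vs : list point) : Prop :=
  (3 <= n)%nat /\ length vs = n /\
  forall i j : nat, (i < n)%nat -> (j < n)%nat -> j <> i -> j <> S i mod n ->
    cross (vsub (vtx vs (S i)) (vtx vs i)) (vsub (vtx vs j) (vtx vs i)) > 0.

(** The closed region bounded by the polygon (intersection of the closed
    left half-planes of its directed edges = convex hull of the vertices). *)
Definition in_polygon (vs : list point) (x : point) : Prop :=
  forall i : nat, (i < length vs)%nat ->
    cross (vsub (vtx vs (S i)) (vtx vs i)) (vsub x (vtx vs i)) >= 0.

Definition internal_angle (vs : list point) (i : nat) : R :=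
  angle (vsub (vtx vs (i + length vs - 1)) (vtx vs i))
        (vsub (vtx vs (S i)) (vtx vs i)).

Definition on_ray (q : point) (th : R) (x : point) : Prop :=
  exists t, 0 <= t /\ x = vadd q (vscale t (dir th)).

Definition in_wedge (omega : R) (q : point) (th : R) (x : point) : Prop :=
  exists a b, 0 <= a /\ 0 <= b /\
    x = vadd q (vadd (vscale a (dir th)) (vscale b (dir (th + omega)))).

(** A directed line: a point on it and a (nonzero) direction vector. *)
Definition dline : Type := (point * point)%type.

Definition on_line (L : dline) (x : point) : Prop :=
  exists t, x = vadd (fst L) (vscale t (snd L)).

Definition valid_probe (omega : R) (vs : list point) (L : dline)
    (q : point) (th : R) : Prop :=
  (forall x, in_polygon vs x -> in_wedge omega q th x) /\
  (exists x, in_polygon vs x /\ on_ray q th x) /\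
  (exists x, in_polygon vs x /\ on_ray q (th + omega) x) /\
  on_line L q /\
  (exists s, 0 <= s /\ in_polygon vs (vadd q (vscale s (snd L)))).

Definition closest_on_ray (vs : list point) (q : point) (th : R) (p1 : point) : Prop :=
  in_polygon vs p1 /\ on_ray q th p1 /\
  forall x, in_polygon vs x -> on_ray q th x -> pdist q p1 <= pdist q x.

(** Outcome of a probe: [None] = "missed", or
    [Some (q, th, p1, p2)]: apex [q], rays of direction angles [th] and
    [th + omega], and the closest contact points [p1], [p2]. *)
Definition outcome : Type := option (point * R * point * point).

Definition probe_answer (omega : R) (vs : list point) (L : dline) (o : outcome) : Prop :=
  match o with
  | None => ~ (exists q th, valid_probe omega vs L q th)
  | Some (q, th, p1, p2) =>
      valid_probe omega vs L q th /\
      closest_on_ray vs q th p1 /\ closest_on_ray vs q (th + omega) p2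
  end.

Inductive action : Type :=
  | Probe : dline -> action
  | Answer : list point -> action.

(** A strategy knows a point [p] of O and a circle (center [c], radius [r])
    enclosing O, and chooses its next action from the history of probes. *)
Definition strategy : Type := point -> point -> R -> list (dline * outcome) -> action.

Fixpoint succeeds (omega : R) (vs : list point) (strat : strategy) (p c : point) (r : R)
    (k : nat) (h : list (dline * outcome)) : Prop :=
  match strat p c r h with
  | Answer out => forall x, In x out <-> In x vs
  | Probe L =>
      match k with
      | O => False
      | S k' => snd L <> (0, 0) /\
          forall o, probe_answer omega vs L o ->
            succeeds omega vs strat p c r k' (h ++ [(L, o)])
      end
  end.

(* Main.v *)
(** The first probe goes through [p] and finds two vertices. Afterwards choose two known vertices
    [a], [b] such that all known vertices lie weakly left of the line [ab], and probe along [ab]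
    itself. As [ab] meets the polygon the probe cannot miss; as the angles exceed [omega] the apex
    lies outside the polygon. Either the right ray runs along [ab], which proves that [ab] is an
    edge, or its contact point is a new vertex strictly right of [ab]. There are [n] vertices and
    [n] edges to find; the first two probes gain two each, so [2n - 2] probes suffice. *)
Require Import Defs.
From Stdlib Require Import Reals List.
From Stdlib Require Import Lra Lia Classical ClassicalEpsilon.
Import ListNotations.
Open Scope R_scope.

(** The prober does not know [n], so the stopping rule has to be readable from the history. A pair
    counts as an edge only when some received wedge lies wholly to its left: the prober can check
    this, and it puts the polygon to the left as well. As long as a vertex is unknown, some known
    vertex is followed on the boundary by an unknown one, and the hull edge of the known vertices
    that leaves it cannot be certified in this way. Hence, when no uncertified pair is left, all
    vertices are known. The angles matter because an apex inside the polygon would be a vertex of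
    internal angle at most [w]. With the apex outside, both contact distances are positive, which
    makes strict the side of the probed line on which a contact lies. *)

Ltac coords := unfold cross, dot, vsub, vadd, vscale in *; cbn [fst snd] in *.

(** * Planar vectors, rays and wedges *)

Lemma cross_dir_plus (th w : R) : cross (dir th) (dir (th + w)) = sin w.
Proof.
  unfold dir; coords. rewrite sin_plus, cos_plus.
  transitivity (sin w * (Rsqr (sin th) + Rsqr (cos th))).
  - unfold Rsqr; ring.
  - rewrite sin2_cos2; ring.
Qed.

Lemma dot_dir_plus (th w : R) : dot (dir th) (dir (th + w)) = cos w.
Proof.
  unfold dir; coords. rewrite sin_plus, cos_plus.
  transitivity (cos w * (Rsqr (sin th) + Rsqr (cos th))).
  - unfold Rsqr; ring.
  - rewrite sin2_cos2; ring.
Qed.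

Lemma dot_dir_self (th : R) : dot (dir th) (dir th) = 1.
Proof. rewrite <- (Rplus_0_r th) at 2. rewrite dot_dir_plus. apply cos_0. Qed.

Lemma polar_form (d : point) :
  d <> (0, 0) -> exists rho phi, 0 < rho /\ d = vscale rho (dir phi).
Proof.
  destruct d as [x y]; intros Hd.
  assert (Hpos : 0 < x * x + y * y).
  { destruct (Rle_lt_dec (x * x + y * y) 0) as [H|H]; [|exact H].
    exfalso; apply Hd; f_equal; nra. }
  set (rho := sqrt (x * x + y * y)).
  assert (Hr : 0 < rho) by (apply sqrt_lt_R0; exact Hpos).
  assert (Hrr : rho * rho = x * x + y * y) by (apply sqrt_sqrt; lra).
  assert (Hb : -1 <= x / rho <= 1).
  { split; apply (Rmult_le_reg_r rho); try lra; unfold Rdiv;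
      rewrite Rmult_assoc, Rinv_l by lra; nra. }
  assert (Hs : sqrt (1 - Rsqr (x / rho)) = Rabs (y / rho)).
  { rewrite <- sqrt_Rsqr_abs; f_equal. unfold Rsqr.
    replace (x / rho * (x / rho)) with ((rho * rho - y * y) / (rho * rho))
      by (rewrite Hrr; replace (x * x + y * y - y * y) with (x * x) by ring;
          rewrite <- Hrr; field; lra).
    field; lra. }
  exists rho.
  destruct (Rle_lt_dec 0 y) as [Hy|Hy].
  - exists (acos (x / rho)); split; [exact Hr|].
    unfold dir; coords; rewrite cos_acos, sin_acos, Hs by exact Hb.
    rewrite Rabs_pos_eq by (apply Rle_mult_inv_pos; lra).
    f_equal; field; lra.
  - exists (- acos (x / rho)); split; [exact Hr|].
    unfold dir; coords; rewrite cos_neg, sin_neg, cos_acos, sin_acos, Hs by exact Hb.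
    rewrite Rabs_left.
    + f_equal; field; lra.
    + unfold Rdiv. apply Rinv_0_lt_compat in Hr. nra.
Qed.

(** Cramer's rule in the basis of the two ray directions, whose determinant is [sin w]. *)
Lemma in_wedge_cross (w : R) (q : point) (th : R) (x : point) :
  0 < sin w ->
  in_wedge w q th x <->
  0 <= cross (dir th) (vsub x q) /\ 0 <= cross (vsub x q) (dir (th + w)).
Proof.
  intros Hw. pose proof (cross_dir_plus th w) as Hc.
  set (d1 := dir th) in *; set (d2 := dir (th + w)) in *.
  split.
  - intros (a & b & Ha & Hb & ->). fold d1 d2.
    assert (E1 : cross d1 (vsub (vadd q (vadd (vscale a d1) (vscale b d2))) q) = b * cross d1 d2)
      by (coords; ring).
    assert (E2 : cross (vsub (vadd q (vadd (vscale a d1) (vscale b d2))) q) d2 = a * cross d1 d2)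
      by (coords; ring).
    rewrite E1, E2, Hc. split; nra.
  - intros [H1 H2].
    exists (cross (vsub x q) d2 / sin w), (cross d1 (vsub x q) / sin w).
    split; [apply Rle_mult_inv_pos; lra|].
    split; [apply Rle_mult_inv_pos; lra|].
    fold d1 d2. rewrite <- Hc in *. clearbody d1 d2.
    destruct x as [x y], q as [q1 q2], d1, d2. coords.
    f_equal; field; lra.
Qed.

Lemma pdist_on_ray (q : point) (th t : R) :
  0 <= t -> pdist q (vadd q (vscale t (dir th))) = t.
Proof.
  intros Ht. unfold pdist, norm.
  replace (dot _ _) with (Rsqr t * dot (dir th) (dir th)) by (unfold Rsqr; coords; ring).
  rewrite dot_dir_self, Rmult_1_r. apply sqrt_Rsqr; exact Ht.
Qed.

(** * Vertices of a convex polygon and their convex combinations *)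

Lemma in_vertices (vs : list point) (x : point) :
  In x vs <-> exists i, (i < length vs)%nat /\ x = vtx vs i.
Proof.
  unfold vtx; split.
  - intros H. destruct (In_nth _ _ (0, 0) H) as (i & Hi & E).
    exists i; rewrite Nat.mod_small by exact Hi; auto.
  - intros (i & Hi & ->). rewrite Nat.mod_small by exact Hi. apply nth_In; exact Hi.
Qed.

Lemma vtx_mod (vs : list point) (i : nat) : vtx vs (i mod length vs) = vtx vs i.
Proof. unfold vtx. now rewrite Nat.Div0.mod_mod. Qed.

Lemma vertex_in_polygon (n : nat) (vs : list point) (x : point) :
  convex_polygon n vs -> In x vs -> in_polygon vs x.
Proof.
  intros (Hn & Hl & Hc).
  rewrite in_vertices; intros (j & Hj & ->) i Hi. rewrite Hl in *.
  destruct (Nat.eq_dec j i) as [->|Hne]; [coords; lra|].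
  destruct (Nat.eq_dec j (S i mod n)) as [->|Hne'].
  - rewrite <- Hl, vtx_mod. coords; lra.
  - left. apply Rgt_lt. now apply Hc.
Qed.

Lemma next_vertex (n : nat) (vs : list point) (i j : nat) :
  convex_polygon n vs -> (i < n)%nat -> (j < n)%nat ->
  vtx vs j = vtx vs i \/ vtx vs j = vtx vs (S i) \/
  0 < cross (vsub (vtx vs (S i)) (vtx vs i)) (vsub (vtx vs j) (vtx vs i)).
Proof.
  intros (Hn & Hl & Hc) Hi Hj.
  destruct (Nat.eq_dec j i) as [->|Hne]; [now left|].
  destruct (Nat.eq_dec j (S i mod n)) as [->|Hne'].
  - right; left. rewrite <- Hl. apply vtx_mod.
  - right; right. now apply Hc.
Qed.

Lemma sign_change (s : nat -> R) (m : nat) :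
  0 <= s 1%nat -> s (S (S m)) <= 0 ->
  exists i, (1 <= i <= S m)%nat /\ 0 <= s i /\ s (S i) <= 0.
Proof.
  intros H1. induction m as [|m IH]; intros H2.
  - exists 1%nat; auto.
  - destruct (Rle_lt_dec (s (S (S m))) 0) as [H|H].
    + destruct (IH H) as (i & Hi & Hs). exists i; split; [lia|exact Hs].
    + exists (S (S m)). split; [lia|split; lra].
Qed.

(* Fan triangulation from vertex 0: the fan ray on which the sign of
   [cross (v_i - v_0) (x - v_0)] changes locates the triangle containing [x]. *)
Lemma polygon_combination (n : nat) (vs : list point) (x : point) :
  convex_polygon n vs -> in_polygon vs x ->
  exists u v w a b c,
    In u vs /\ In v vs /\ In w vs /\ 0 <= a /\ 0 <= b /\ 0 <= c /\ a + b + c = 1 /\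
    x = vadd (vscale a u) (vadd (vscale b v) (vscale c w)).
Proof.
  intros (Hn & Hl & Hc) Hx.
  destruct n as [|[|[|m]]]; try lia.
  set (s i := cross (vsub (vtx vs i) (vtx vs 0)) (vsub x (vtx vs 0))).
  destruct (sign_change s m) as (i & Hi & Hs1 & Hs2).
  - pose proof (Hx 0%nat ltac:(lia)). unfold s; lra.
  (* The edge from the last vertex, [S (S m)], back to vertex 0 gives the sign at the far end of the
     fan. *)
  - pose proof (Hx (S (S m)) ltac:(lia)) as H.
    assert (E : vtx vs (S (S (S m))) = vtx vs 0)
      by (rewrite <- Hl; unfold vtx; now rewrite Nat.Div0.mod_same, Nat.Div0.mod_0_l).
    rewrite E in H. unfold s. coords; lra.
  - pose proof (Hx i ltac:(lia)) as Hs3.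
    pose proof (Hc i 0%nat ltac:(lia) ltac:(lia) ltac:(lia)
      ltac:(rewrite Nat.mod_small; lia)) as HD.
    exists (vtx vs 0), (vtx vs i), (vtx vs (S i)).
    (* [D] is twice the area of the fan triangle; the weights are the barycentric coordinates of
       [x], ratios of triangle areas. *)
    set (D := cross (vsub (vtx vs (S i)) (vtx vs i)) (vsub (vtx vs 0) (vtx vs i))) in *.
    exists (cross (vsub (vtx vs (S i)) (vtx vs i)) (vsub x (vtx vs i)) / D),
      (- s (S i) / D), (s i / D).
    split; [apply in_vertices; exists 0%nat; split; [lia|reflexivity]|].
    split; [apply in_vertices; exists i; split; [lia|reflexivity]|].
    split; [apply in_vertices; exists (S i); split; [lia|reflexivity]|].
    split; [apply Rle_mult_inv_pos; lra|].
    split; [apply Rle_mult_inv_pos; lra|].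
    split; [apply Rle_mult_inv_pos; lra|].
    unfold D, s in *.
    destruct (vtx vs 0), (vtx vs i), (vtx vs (S i)), x. coords.
    split; [|f_equal]; field; lra.
Qed.

Lemma polygon_halfplane (n : nat) (vs : list point) (e q x : point) :
  convex_polygon n vs -> in_polygon vs x ->
  (forall v, In v vs -> 0 <= cross e (vsub v q)) -> 0 <= cross e (vsub x q).
Proof.
  intros Hconv Hx H.
  destruct (polygon_combination n vs x Hconv Hx)
    as (u & v & w & a & b & c & Hu & Hv & Hw & Ha & Hb & Hc & Hs & E).
  apply H in Hu, Hv, Hw.
  replace (cross e (vsub x q)) with
    (a * cross e (vsub u q) + b * cross e (vsub v q) + c * cross e (vsub w q)).
  - pose proof (Rmult_le_pos _ _ Ha Hu). pose proof (Rmult_le_pos _ _ Hb Hv).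
    pose proof (Rmult_le_pos _ _ Hc Hw). lra.
  - rewrite E. replace c with (1 - a - b) by lra. coords; ring.
Qed.

(** Order points by [cross e], with ties broken by [dot e']. If [x] were not a vertex, it would be a
    convex combination of points all strictly larger than itself in this order, and then every
    weight would vanish. *)
Lemma lexicographic_min_vertex (n : nat) (vs : list point) (e e' x : point) :
  convex_polygon n vs -> in_polygon vs x ->
  (forall v, In v vs -> v <> x ->
     0 < cross e (vsub v x) \/ cross e (vsub v x) = 0 /\ 0 < dot e' (vsub v x)) ->
  In x vs.
Proof.
  intros Hconv Hx H. destruct (classic (In x vs)) as [|Hn]; [assumption|exfalso].
  destruct (polygon_combination n vs x Hconv Hx)
    as (u & v & w & a & b & c & Hu & Hv & Hw & Ha & Hb & Hc & Hs & E).
  assert (Hne : forall y, In y vs -> y <> x) by (intros y Hy ->; contradiction).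
  assert (Hterm : forall t y, 0 <= t -> In y vs ->
    0 <= t * cross e (vsub y x) /\
    (t * cross e (vsub y x) = 0 -> 0 <= t * dot e' (vsub y x) /\
       (t * dot e' (vsub y x) = 0 -> t = 0))).
  { intros t y Ht Hy. destruct (H y Hy (Hne y Hy)) as [Hf|[Hf Hg]].
    - split; [nra|]. intros H0. assert (t = 0) by nra. subst t. split; [lra|auto].
    - rewrite Hf. split; [lra|]. intros _. split; [nra|]. intros; nra. }
  destruct (Hterm a u Ha Hu) as [Fu Gu], (Hterm b v Hb Hv) as [Fv Gv], (Hterm c w Hc Hw) as [Fw Gw].
  assert (F : a * cross e (vsub u x) + b * cross e (vsub v x) + c * cross e (vsub w x) = 0).
  { transitivity (cross e (vsub (vadd (vscale a u) (vadd (vscale b v) (vscale c w)))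
                               (vscale (a + b + c) x))); [coords; ring|].
    rewrite <- E, Hs. coords; ring. }
  assert (G : a * dot e' (vsub u x) + b * dot e' (vsub v x) + c * dot e' (vsub w x) = 0).
  { transitivity (dot e' (vsub (vadd (vscale a u) (vadd (vscale b v) (vscale c w)))
                               (vscale (a + b + c) x))); [coords; ring|].
    rewrite <- E, Hs. coords; ring. }
  destruct Gu as [Gu Zu]; [lra|]. destruct Gv as [Gv Zv]; [lra|]. destruct Gw as [Gw Zw]; [lra|].
  rewrite Zu, Zv, Zw in Hs; lra.
Qed.

Lemma vtx_in (n : nat) (vs : list point) (i : nat) :
  convex_polygon n vs -> In (vtx vs i) vs.
Proof.
  intros (Hn & Hl & _). unfold vtx. apply nth_In. apply Nat.mod_upper_bound. lia.
Qed.

(** Since [n >= 3] there is a third vertex, and it cannot lie strictly to the left of a zero edge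
    vector. *)
Lemma next_vertex_neq (n : nat) (vs : list point) (i : nat) :
  convex_polygon n vs -> (i < n)%nat -> vtx vs (S i) <> vtx vs i.
Proof.
  intros (Hn & Hl & Hc) Hi E.
  assert (exists k, (k < n)%nat /\ k <> i /\ k <> S i mod n) as (k & Hk & Hki & HkS).
  { destruct (Nat.eq_dec (S i) n) as [Ei|Ei].
    - exists 1%nat. rewrite Ei, Nat.Div0.mod_same. lia.
    - rewrite Nat.mod_small by lia.
      destruct i as [|i]; [exists 2%nat|exists 0%nat]; lia. }
  pose proof (Hc i k Hi Hk Hki HkS) as H. rewrite E in H. coords; lra.
Qed.

Lemma prev_vertex_neq (n : nat) (vs : list point) (i : nat) :
  convex_polygon n vs -> (i < n)%nat -> vtx vs (i + length vs - 1) <> vtx vs i.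
Proof.
  intros Hconv Hi. pose proof Hconv as (Hn & Hl & _). rewrite Hl.
  destruct i as [|i].
  - intros E. apply (next_vertex_neq n vs (n - 1) Hconv); [lia|].
    replace (S (n - 1)) with n by lia.
    replace (0 + n - 1)%nat with (n - 1)%nat in E by lia.
    rewrite E. rewrite <- (vtx_mod vs n), Hl, Nat.Div0.mod_same. reflexivity.
  - intros E. apply (next_vertex_neq n vs i Hconv); [lia|]. rewrite <- E.
    replace (S i + n - 1)%nat with (i + 1 * n)%nat by lia.
    unfold vtx. rewrite Hl, Nat.Div0.mod_add. reflexivity.
Qed.

(** * Contact points and apex of a wedge around the polygon *)

Lemma dot_vsub_pos (x y : point) : x <> y -> 0 < dot (vsub x y) (vsub x y).
Proof.
  destruct x as [x1 x2], y as [y1 y2]; intros H. coords.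
  destruct (Rle_lt_dec ((x1 - y1) * (x1 - y1) + (x2 - y2) * (x2 - y2)) 0) as [H0|H0]; [|exact H0].
  destruct (Rplus_sqr_eq_0 (x1 - y1) (x2 - y2)) as [E1 E2].
  { pose proof (Rle_0_sqr (x1 - y1)). pose proof (Rle_0_sqr (x2 - y2)). unfold Rsqr in *; lra. }
  exfalso; apply H; f_equal; lra.
Qed.

(** With [A = a * b'] and [B = b * a'], the cross product is [(A - B) * sin w], and the dot product
    [T] is at least [cos w * (A + B)], because [cos w >= 0] for [w <= PI / 2]. By Lagrange's
    identity the product [N] of the norms satisfies [N^2 = T^2 + (A - B)^2 * sin^2 w]. Multiplying
    by [cos^2 w] and using [cos w * |A - B| <= T] gives [cos w * N <= T]. *)
Lemma wedge_angle_le (w : R) (q : point) (th : R) (x y : point) :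
  0 < w <= PI / 2 -> in_wedge w q th x -> in_wedge w q th y -> x <> q -> y <> q ->
  angle (vsub x q) (vsub y q) <= w.
Proof.
  intros Hw (a & b & Ha & Hb & Ex) (a' & b' & Ha' & Hb' & Ey) Hx Hy.
  pose proof PI_RGT_0 as Hpi.
  assert (Hs : 0 < sin w) by (apply sin_gt_0; lra).
  assert (Hc : 0 <= cos w) by (apply cos_ge_0; lra).
  pose proof (sin2_cos2 w) as Hsc. unfold Rsqr in Hsc.
  pose proof (dot_vsub_pos x q Hx) as HU. pose proof (dot_vsub_pos y q Hy) as HV.
  assert (HT : dot (vsub x q) (vsub y q) = a * a' + b * b' + cos w * (a * b' + b * a')).
  { rewrite <- (dot_dir_plus th w). rewrite Ex, Ey.
    transitivity (a * a' * dot (dir th) (dir th) + b * b' * dot (dir (th + w)) (dir (th + w))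
                  + dot (dir th) (dir (th + w)) * (a * b' + b * a')); [coords; ring|].
    rewrite !dot_dir_self; ring. }
  assert (HX : cross (vsub x q) (vsub y q) = (a * b' - b * a') * sin w).
  { rewrite <- (cross_dir_plus th w). rewrite Ex, Ey. coords; ring. }
  assert (HL : dot (vsub x q) (vsub x q) * dot (vsub y q) (vsub y q) =
    dot (vsub x q) (vsub y q) * dot (vsub x q) (vsub y q)
    + cross (vsub x q) (vsub y q) * cross (vsub x q) (vsub y q)) by (coords; ring).
  unfold angle, norm. rewrite <- sqrt_mult by lra.
  set (N := sqrt (dot (vsub x q) (vsub x q) * dot (vsub y q) (vsub y q))).
  assert (HN : 0 < N) by (apply sqrt_lt_R0; nra).
  assert (HNN : N * N = dot (vsub x q) (vsub x q) * dot (vsub y q) (vsub y q))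
    by (apply sqrt_sqrt; nra).
  rewrite HL, HX in HNN.
  set (T := dot (vsub x q) (vsub y q)) in *.
  clearbody N T. clear HL HX HU HV Ex Ey Hx Hy.
  pose proof (Rmult_le_pos _ _ Ha Ha') as P1. pose proof (Rmult_le_pos _ _ Hb Hb') as P2.
  pose proof (Rmult_le_pos _ _ Ha Hb') as P3. pose proof (Rmult_le_pos _ _ Hb Ha') as P4.
  set (A := a * b') in *. set (B := b * a') in *. clearbody A B.
  pose proof (Rmult_le_pos _ _ Hc P3) as P5. pose proof (Rmult_le_pos _ _ Hc P4) as P6.
  assert (HTpos : 0 <= T) by lra.
  assert (HTc : cos w * (A - B) * (cos w * (A - B)) <= T * T).
  { assert (cos w * (A - B) * (cos w * (A - B)) <= (cos w * (A + B)) * (cos w * (A + B)))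
      by (pose proof (Rmult_le_pos _ _ P5 P6); nra).
    assert ((cos w * (A + B)) * (cos w * (A + B)) <= T * T) by (apply Rmult_le_compat; lra).
    lra. }
  assert (Hlow : cos w * N <= T).
  { apply Rsqr_incr_0_var; [|exact HTpos]. unfold Rsqr.
    replace (cos w * N * (cos w * N)) with (cos w * cos w * (N * N)) by ring.
    rewrite HNN.
    replace (cos w * cos w * (T * T + (A - B) * sin w * ((A - B) * sin w)))
      with (cos w * cos w * (T * T) + sin w * sin w * (cos w * (A - B) * (cos w * (A - B))))
      by ring.
    replace (T * T) with (cos w * cos w * (T * T) + sin w * sin w * (T * T)) at 2
      by (rewrite <- Rmult_plus_distr_r, (Rplus_comm (cos w * cos w)), Hsc; ring).
    apply Rplus_le_compat_l, Rmult_le_compat_l; [nra|exact HTc]. }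
  assert (Hup : T <= N).
  { apply Rsqr_incr_0_var; [|lra]. unfold Rsqr. rewrite HNN.
    pose proof (Rle_0_sqr ((A - B) * sin w)) as H. unfold Rsqr in H. lra. }
  assert (Hz1 : T / N <= 1) by (apply (Rmult_le_reg_r N); [lra|]; unfold Rdiv;
    rewrite Rmult_assoc, Rinv_l; lra).
  assert (Hz0 : cos w <= T / N) by (apply (Rmult_le_reg_r N); [lra|]; unfold Rdiv;
    rewrite Rmult_assoc, Rinv_l; lra).
  destruct (Rle_lt_dec (acos (T / N)) w) as [H|H]; [exact H|exfalso].
  pose proof (acos_bound (T / N)) as Hb2.
  apply cos_decreasing_1 in H; try lra. rewrite cos_acos in H; lra.
Qed.

(** The closest contact is lexicographically minimal: it lies on the supporting line carrying the
    ray, and among the points there it comes first along the ray. The sign of [k] tells on which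
    side of the ray the polygon lies, so that one lemma serves both rays, with [k = 1] and
    [k = -1]. *)
Lemma closest_contact_vertex (n : nat) (vs : list point) (k : R) (q : point) (th : R) (p : point) :
  convex_polygon n vs -> k <> 0 ->
  (forall y, in_polygon vs y -> 0 <= k * cross (dir th) (vsub y q)) ->
  (forall y, in_polygon vs y -> cross (dir th) (vsub y q) = 0 -> on_ray q th y) ->
  closest_on_ray vs q th p -> In p vs.
Proof.
  intros Hconv Hk Hside Hray (Hp & (t & Ht & Ep) & Hmin).
  apply (lexicographic_min_vertex n vs (vscale k (dir th)) (dir th)); auto.
  intros v Hv Hne. apply (vertex_in_polygon n vs v Hconv) in Hv.
  assert (E : cross (vscale k (dir th)) (vsub v p) = k * cross (dir th) (vsub v q))
    by (rewrite Ep; coords; ring).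
  rewrite E. destruct (Hside v Hv) as [H|H]; [now left|right].
  split; [now symmetry|].
  assert (H0 : cross (dir th) (vsub v q) = 0)
    by (symmetry in H; apply Rmult_integral in H; tauto).
  destruct (Hray v Hv H0) as (t' & Ht' & Ev).
  pose proof (Hmin v Hv (Hray v Hv H0)) as Hd.
  rewrite Ep, Ev, !pdist_on_ray in Hd by assumption.
  assert (t <> t') by (intros ->; apply Hne; congruence).
  replace (dot (dir th) (vsub v p)) with ((t' - t) * dot (dir th) (dir th))
    by (rewrite Ep, Ev; coords; ring).
  rewrite dot_dir_self. lra.
Qed.

Lemma closest_left_vertex (n : nat) (vs : list point) (w : R) (q : point) (th : R) (p : point) :
  convex_polygon n vs -> 0 < sin w ->
  (forall x, in_polygon vs x -> in_wedge w q th x) ->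
  closest_on_ray vs q th p -> In p vs.
Proof.
  intros Hconv Hs Hsub. apply (closest_contact_vertex n vs 1); [exact Hconv|lra| |].
  - intros y Hy. apply Hsub, in_wedge_cross in Hy; [lra|exact Hs].
  - intros y Hy H0. destruct (Hsub y Hy) as (a & b & Ha & Hb & ->).
    exists a; split; [exact Ha|].
    assert (E : b * sin w = 0) by (rewrite <- H0, <- (cross_dir_plus th w); coords; ring).
    apply Rmult_integral in E as [->|E]; [|lra]. coords; f_equal; ring.
Qed.

Lemma closest_right_vertex (n : nat) (vs : list point) (w : R) (q : point) (th : R) (p : point) :
  convex_polygon n vs -> 0 < sin w ->
  (forall x, in_polygon vs x -> in_wedge w q th x) ->
  closest_on_ray vs q (th + w) p -> In p vs.
Proof.
  intros Hconv Hs Hsub. apply (closest_contact_vertex n vs (-1)); [exact Hconv|lra| |].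
  - intros y Hy. apply Hsub, in_wedge_cross in Hy; [|exact Hs].
    destruct Hy as [_ Hy]. coords; lra.
  - intros y Hy H0. destruct (Hsub y Hy) as (a & b & Ha & Hb & ->).
    exists b; split; [exact Hb|].
    assert (E : a * sin w = 0)
      by (rewrite <- (Ropp_involutive 0), Ropp_0, <- H0, <- (cross_dir_plus th w); coords; ring).
    apply Rmult_integral in E as [->|E]; [|lra]. coords; f_equal; ring.
Qed.

(** An apex in the polygon is its own closest contact, at distance 0, hence a vertex. Its two
    neighbours lie in the wedge, so its internal angle is at most [w]. *)
Lemma apex_outside (n : nat) (vs : list point) (w : R) (q : point) (th : R) :
  0 < w <= PI / 2 -> convex_polygon n vs ->
  (forall i : nat, (i < n)%nat -> internal_angle vs i > w) ->
  (forall x, in_polygon vs x -> in_wedge w q th x) -> ~ in_polygon vs q.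
Proof.
  intros Hw Hconv Hang Hsub Hq. pose proof PI_RGT_0.
  assert (E0 : q = vadd q (vscale 0 (dir th)))
    by (destruct q; coords; f_equal; ring).
  assert (Hv : In q vs).
  { apply (closest_left_vertex n vs w q th); auto; [apply sin_gt_0; lra|].
    split; [exact Hq|split].
    - exists 0; split; [lra|exact E0].
    - intros x _ (t & Ht & ->). rewrite E0 at 2. rewrite !pdist_on_ray; lra. }
  apply in_vertices in Hv as (i & Hi & Eq).
  pose proof Hconv as (_ & Hl & _). rewrite Hl in Hi.
  specialize (Hang i Hi). apply Rgt_not_le in Hang. apply Hang.
  unfold internal_angle. rewrite <- Eq.
  apply (wedge_angle_le w q th); auto.
  - apply Hsub, (vertex_in_polygon n); [exact Hconv|]. now apply (vtx_in n).
  - apply Hsub, (vertex_in_polygon n); [exact Hconv|]. now apply (vtx_in n).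
  - rewrite Eq. now apply (prev_vertex_neq n).
  - rewrite Eq. now apply (next_vertex_neq n).
Qed.

Lemma probe_contacts (n : nat) (vs : list point) (w : R) (L : dline)
    (q : point) (th : R) (p1 p2 : point) :
  0 < w <= PI / 2 -> convex_polygon n vs ->
  (forall i : nat, (i < n)%nat -> internal_angle vs i > w) ->
  probe_answer w vs L (Some (q, th, p1, p2)) ->
  In p1 vs /\ In p2 vs /\ exists t1 t2, 0 < t1 /\ 0 < t2 /\
    p1 = vadd q (vscale t1 (dir th)) /\ p2 = vadd q (vscale t2 (dir (th + w))).
Proof.
  intros Hw Hconv Hang ((Hsub & _) & H1 & H2). pose proof PI_RGT_0.
  assert (Hs : 0 < sin w) by (apply sin_gt_0; lra).
  pose proof (apex_outside n vs w q th Hw Hconv Hang Hsub) as Hout.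
  split; [now apply (closest_left_vertex n vs w q th)|].
  split; [now apply (closest_right_vertex n vs w q th)|].
  assert (Hpos : forall al p, closest_on_ray vs q al p ->
    exists t, 0 < t /\ p = vadd q (vscale t (dir al))).
  { intros al p (Hp & (t & Ht & E) & _). exists t; split; [|exact E].
    destruct Ht as [Ht|<-]; [exact Ht|exfalso; apply Hout].
    rewrite E in Hp. replace (vadd q _) with q in Hp; [exact Hp|].
    destruct q; coords; f_equal; ring. }
  destruct (Hpos _ _ H1) as (t1 & ? & ?), (Hpos _ _ H2) as (t2 & ? & ?).
  exists t1, t2; auto.
Qed.

Lemma probe_contacts_neq (n : nat) (vs : list point) (w : R) (L : dline)
    (q : point) (th : R) (p1 p2 : point) :
  0 < w <= PI / 2 -> convex_polygon n vs ->
  (forall i : nat, (i < n)%nat -> internal_angle vs i > w) ->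
  probe_answer w vs L (Some (q, th, p1, p2)) -> p1 <> p2.
Proof.
  intros Hw Hconv Hang Hans. pose proof PI_RGT_0.
  assert (Hs : 0 < sin w) by (apply sin_gt_0; lra).
  destruct (probe_contacts n vs w L q th p1 p2) as (_ & _ & t1 & t2 & H1 & H2 & E1 & E2); auto.
  intros E. assert (H0 : t2 * sin w = 0).
  { rewrite <- (cross_dir_plus th w).
    transitivity (cross (dir th) (vsub p2 q)); [rewrite E2; coords; ring|].
    rewrite <- E, E1. coords; ring. }
  nra.
Qed.

(** Stated for the wedge and not for the polygon, because the prober sees only the wedge. *)
Definition wedge_left_of (w : R) (q : point) (th : R) (a b : point) : Prop :=
  forall x, in_wedge w q th x -> 0 <= cross (vsub b a) (vsub x a).

(* The directed line [ab] meets the polygon, so [b - a] is a nonnegative combination of the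
   directions of the two rays; the three cases are whether one of the coefficients vanishes. *)
Lemma probe_through_pair (n : nat) (vs : list point) (w : R) (a b q : point) (th : R)
    (p1 p2 : point) :
  0 < w <= PI / 2 -> convex_polygon n vs ->
  (forall i : nat, (i < n)%nat -> internal_angle vs i > w) ->
  a <> b ->
  probe_answer w vs (a, vsub b a) (Some (q, th, p1, p2)) ->
  (cross (vsub b a) (vsub p1 a) < 0 /\ 0 < cross (vsub b a) (vsub p2 a)) \/
  (wedge_left_of w q th a b /\ 0 < cross (vsub b a) (vsub p2 a)) \/
  (wedge_left_of w q th b a /\ cross (vsub b a) (vsub p1 a) < 0).
Proof.
  intros Hw Hconv Hang Hab Hans. pose proof PI_RGT_0.
  assert (Hs : 0 < sin w) by (apply sin_gt_0; lra).
  destruct (probe_contacts n vs w (a, vsub b a) q th p1 p2)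
    as (_ & _ & t1 & t2 & Ht1 & Ht2 & E1 & E2); auto.
  destruct Hans as ((Hsub & _ & _ & (t & Eq) & (s & Hs0 & Hx)) & _).
  cbn [fst snd] in Eq, Hx.
  pose proof (apex_outside n vs w q th Hw Hconv Hang Hsub) as Hout.
  pose proof (cross_dir_plus th w) as Hc.
  destruct Hs0 as [Hs0|<-].
  2: { exfalso; apply Hout. replace q with (vadd q (vscale 0 (vsub b a))); [exact Hx|].
       destruct q; coords; f_equal; ring. }
  destruct (Hsub _ Hx) as (al & be & Hal & Hbe & Ed).
  assert (Ez : vsub b a = vadd (vscale (al / s) (dir th)) (vscale (be / s) (dir (th + w)))).
  { unfold dir in Ed |- *. destruct q, a, b. coords. injection Ed as Ed1 Ed2.
    f_equal; apply (Rmult_eq_reg_l s); try lra; field_simplify; lra. }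
  assert (Hline : forall y, cross (vsub b a) (vsub y a) = cross (vsub b a) (vsub y q))
    by (intros y; rewrite Eq; coords; ring).
  pose proof (Rle_mult_inv_pos _ _ Hal Hs0) as Hal'.
  pose proof (Rle_mult_inv_pos _ _ Hbe Hs0) as Hbe'.
  change (al * / s) with (al / s) in Hal'. change (be * / s) with (be / s) in Hbe'.
  set (A := al / s) in *. set (B := be / s) in *. clearbody A B.
  assert (C1 : cross (vsub b a) (vsub p1 a) = - (t1 * B * sin w))
    by (rewrite Hline, Ez, E1, <- Hc; coords; ring).
  assert (C2 : cross (vsub b a) (vsub p2 a) = t2 * A * sin w)
    by (rewrite Hline, Ez, E2, <- Hc; coords; ring).
  assert (CW : forall x y, cross (vsub b a) (vsub (vadd q (vadd (vscale x (dir th))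
      (vscale y (dir (th + w))))) a) = (A * y - B * x) * sin w)
    by (intros x y; rewrite Hline, Ez, <- Hc; coords; ring).
  rewrite C1, C2.
  assert (P : forall u v, 0 < u -> 0 < v -> 0 < u * v * sin w)
    by (intros; repeat apply Rmult_lt_0_compat; assumption).
  (* If both coefficients are positive, the line separates the two contacts. If [B = 0] it runs
     along the ray [th], with the wedge on its left; if [A = 0] it runs along the ray [th + w], with
     the wedge on its right. If both vanish, [a = b]. *)
  destruct Hal' as [HA|HA], Hbe' as [HB|HB].
  - left. pose proof (P t1 B Ht1 HB). pose proof (P t2 A Ht2 HA). lra.
  - right; left. split; [|auto]. intros x (x1 & x2 & Hx1 & Hx2 & ->).
    rewrite CW, <- HB. pose proof (Rmult_le_pos _ _ (Rlt_le _ _ HA) Hx2). nra.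
  - right; right. split; [|pose proof (P t1 B Ht1 HB); lra].
    intros x (x1 & x2 & Hx1 & Hx2 & ->).
    assert (E : forall y, cross (vsub a b) (vsub y b) = - cross (vsub b a) (vsub y a))
      by (intros; coords; ring).
    rewrite E, CW, <- HA. pose proof (Rmult_le_pos _ _ (Rlt_le _ _ HB) Hx1). nra.
  - exfalso; apply Hab. rewrite <- HA, <- HB in Ez. destruct a, b. coords.
    injection Ez; intros. f_equal; lra.
Qed.

(** * Existence of a valid probe on a line through the polygon *)

Lemma continuous_min (vs : list point) (f : point -> R -> R) :
  vs <> [] -> (forall v, continuity (f v)) ->
  exists m, continuity m /\ forall t,
    (forall v, In v vs -> m t <= f v t) /\ exists v, In v vs /\ m t = f v t.
Proof.
  intros Hne Hf. destruct vs as [|u l]; [contradiction|]. clear Hne.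
  revert u. induction l as [|v l IH]; intros u.
  - exists (f u). split; [apply Hf|]. intros t. split.
    + intros v [<-|[]]; lra.
    + exists u; split; [now left|reflexivity].
  - destruct (IH v) as (m & Hm & H).
    (* The minimum of two numbers as half of their sum minus their distance, so that continuity
       follows from that of [Rabs]. *)
    exists (fun t => (f u t + m t - Rabs (f u t - m t)) * / 2). split.
    + apply (continuity_mult ((f u + m) - (comp Rabs (f u - m)))%F (fct_cte (/ 2))).
      * apply continuity_minus; [now apply continuity_plus|].
        apply continuity_comp; [now apply continuity_minus|exact Rcontinuity_abs].
      * apply continuity_const. intros x y; reflexivity.
    + intros t. destruct (H t) as [Hle (y & Hy & E)].
      destruct (Rle_lt_dec (f u t) (m t)) as [C|C].
      * rewrite Rabs_left1 by lra. split.
        -- intros x [<-|Hx]; [lra|]. specialize (Hle x Hx); lra.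
        -- exists u; split; [now left|lra].
      * rewrite Rabs_pos_eq by lra. split.
        -- intros x [<-|Hx]; [lra|]. specialize (Hle x Hx); lra.
        -- exists y; split; [now right|lra].
Qed.

(** The offset [al] covers both rays, with [al = 0] and [al = w]; this is why [t + 0] appears
    below. *)
Lemma continuity_cross_dir (v : point) (al : R) :
  continuity (fun t => cross (dir (t + al)) v).
Proof.
  unfold dir, cross; cbn [fst snd]. intros t. reg.
Qed.

(* For every direction [th] there is a unique wedge with rays [th] and [th + w] touching the
   polygon on both sides. As [th] runs from [phi - w] to [phi], where [phi] is the direction of
   the line, its apex moves from one side of the line to the other. *)
Lemma valid_probe_exists (n : nat) (vs : list point) (w : R) (L : dline) :
  0 < w <= PI / 2 -> convex_polygon n vs -> in_polygon vs (fst L) -> snd L <> (0, 0) ->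
  exists q th, valid_probe w vs L q th.
Proof.
  destruct L as [x d]; cbn [fst snd]. intros Hw Hconv Hx Hd. pose proof PI_RGT_0.
  assert (Hs : 0 < sin w) by (apply sin_gt_0; lra).
  destruct (polar_form d Hd) as (rho & phi & Hrho & Ed).
  assert (Hne : vs <> []).
  { intros E. destruct Hconv as (Hn & Hl & _). rewrite E in Hl. simpl in Hl. lia. }
  (* [m1 t] and [m2 t] are the offsets of the supporting lines in the directions [t] and [t + w],
     with the polygon to the left of the first and to the right of the second. The factor [-1] swaps
     the arguments of [cross]. *)
  destruct (continuous_min vs (fun v t => cross (dir (t + 0)) v) Hne) as (m1 & Cm1 & Hm1);
    [intros v; apply continuity_cross_dir|].
  destruct (continuous_min vs (fun v t => cross (dir (t + w)) (vscale (-1) v)) Hne)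
    as (m2 & Cm2 & Hm2); [intros v; apply continuity_cross_dir|].
  assert (Hm1x : forall t, m1 t <= cross (dir t) x).
  (* [q] is the foot of the perpendicular from the origin to the supporting line, a base point for
     [polygon_halfplane]. *)
  { intros t. set (q := vscale (m1 t) (- snd (dir t), fst (dir t))).
    assert (E : forall v, cross (dir t) (vsub v q) = cross (dir t) v - m1 t).
    { intros v. rewrite <- (Rmult_1_r (m1 t)).
      rewrite <- (dot_dir_self t). unfold q. coords; ring. }
    assert (0 <= cross (dir t) (vsub x q)); [|rewrite E in *; lra].
    apply (polygon_halfplane n vs); auto. intros v Hv. rewrite E.
    destruct (Hm1 t) as [Hle _]. specialize (Hle v Hv). cbv beta in Hle.
    rewrite Rplus_0_r in Hle. lra. }
  assert (Hm2x : forall t, m2 t <= cross x (dir (t + w))).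
  { intros t. set (q := vscale (m2 t) (snd (dir (t + w)), - fst (dir (t + w)))).
    assert (E : forall v, cross (vscale (-1) (dir (t + w))) (vsub v q)
                          = cross v (dir (t + w)) - m2 t).
    { intros v. rewrite <- (Rmult_1_r (m2 t)).
      rewrite <- (dot_dir_self (t + w)). unfold q. coords; ring. }
    assert (0 <= cross (vscale (-1) (dir (t + w))) (vsub x q)); [|rewrite E in *; lra].
    apply (polygon_halfplane n vs); auto. intros v Hv. rewrite E.
    destruct (Hm2 t) as [Hle _]. specialize (Hle v Hv). cbv beta in Hle.
    coords. lra. }
  (* The supporting lines meet at the apex [(m2 t * dir t + m1 t * dir (t + w)) / sin w]. [F t] is
     [sin w] times its signed offset from the line through [x] in direction [phi], so a zero of [F]
     puts the apex on the line. *)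
  set (F t := m2 t * cross (dir (t + 0)) (vscale (-1) (dir phi))
            + m1 t * cross (dir (t + w)) (vscale (-1) (dir phi))
            - sin w * cross (dir phi) x).
  assert (CF : continuity F).
  { apply (continuity_minus
      ((m2 * (fun t => cross (dir (t + 0)) (vscale (-1) (dir phi))))
       + (m1 * (fun t => cross (dir (t + w)) (vscale (-1) (dir phi)))))%F
      (fct_cte (sin w * cross (dir phi) x))).
    - apply continuity_plus; apply continuity_mult; auto; apply continuity_cross_dir.
    - apply continuity_const. intros y z; reflexivity. }
  (* At [t = phi] the ray [t] is parallel to the line and has [x] weakly on its left; at
     [t = phi - w] the other ray is parallel and has [x] weakly on its right. *)
  assert (F1 : F phi <= 0).
  { unfold F. rewrite Rplus_0_r.
    replace (cross (dir phi) (vscale (-1) (dir phi))) with 0 by (coords; ring).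
    replace (cross (dir (phi + w)) (vscale (-1) (dir phi))) with (sin w)
      by (rewrite <- (cross_dir_plus phi w); coords; ring).
    specialize (Hm1x phi). nra. }
  assert (F0 : 0 <= F (phi - w)).
  { unfold F. rewrite Rplus_0_r.
    replace (phi - w + w) with phi by ring.
    replace (cross (dir phi) (vscale (-1) (dir phi))) with 0 by (coords; ring).
    replace (cross (dir (phi - w)) (vscale (-1) (dir phi))) with (- sin w)
      by (rewrite <- (cross_dir_plus (phi - w) w); replace (phi - w + w) with phi by ring;
          coords; ring).
    specialize (Hm2x (phi - w)). replace (phi - w + w) with phi in Hm2x by ring.
    assert (E : cross (dir phi) x = - cross x (dir phi)) by (coords; ring). rewrite E. nra. }
  destruct (IVT_cor F (phi - w) phi CF) as (th & Hth & HF); [lra|nra|].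
  unfold F in HF. rewrite Rplus_0_r in HF.
  destruct (Hm1 th) as [Hle1 (v1 & Hv1 & Ev1)], (Hm2 th) as [Hle2 (v2 & Hv2 & Ev2)].
  cbv beta in *. rewrite Rplus_0_r in *. clear F CF F0 F1.
  pose proof (cross_dir_plus th w) as Hc.
  pose proof (dot_dir_self phi) as Hphi.
  (* As [th] lies between [phi - w] and [phi], the direction [phi] points into the wedge. *)
  assert (Hd1 : cross (dir th) (dir phi) = sin (phi - th))
    by (replace phi with (th + (phi - th)) at 1 by ring; apply cross_dir_plus).
  assert (Hd2 : cross (dir phi) (dir (th + w)) = sin (th + w - phi))
    by (replace (th + w) with (phi + (th + w - phi)) by ring;
        rewrite cross_dir_plus; f_equal; ring).
  assert (Hd1' : 0 <= sin (phi - th)) by (apply sin_ge_0; lra).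
  assert (Hd2' : 0 <= sin (th + w - phi)) by (apply sin_ge_0; lra).
  rewrite <- Hd1 in Hd1'. rewrite <- Hd2 in Hd2'. clear Hd1 Hd2.
  set (q := vadd (vscale (m2 th / sin w) (dir th)) (vscale (m1 th / sin w) (dir (th + w)))).
  assert (Q1 : forall v, cross (dir th) (vsub v q) = cross (dir th) v - m1 th).
  { intros v. transitivity (cross (dir th) v - m1 th / sin w * cross (dir th) (dir (th + w)));
      [unfold q; coords; ring|]. rewrite Hc. field; lra. }
  assert (Q2 : forall v, cross (vsub v q) (dir (th + w)) = cross v (dir (th + w)) - m2 th).
  { intros v. transitivity (cross v (dir (th + w)) - m2 th / sin w * cross (dir th) (dir (th + w)));
      [unfold q; coords; ring|]. rewrite Hc. field; lra. }
  assert (Q3 : cross (dir phi) (vsub x q) = 0).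
  { apply (Rmult_eq_reg_l (sin w)); [|lra].
    transitivity (sin w * cross (dir phi) x
      - sin w * (m2 th / sin w * cross (dir phi) (dir th)
                 + m1 th / sin w * cross (dir phi) (dir (th + w))));
      [unfold q; coords; ring|].
    replace (sin w * (m2 th / sin w * cross (dir phi) (dir th)
                 + m1 th / sin w * cross (dir phi) (dir (th + w))))
      with (m2 th * cross (dir phi) (dir th) + m1 th * cross (dir phi) (dir (th + w)))
      by (field; lra).
    coords; lra. }
  assert (Hle2' : forall v, In v vs -> m2 th <= cross v (dir (th + w)))
    by (intros v Hv; specialize (Hle2 v Hv); coords; lra).
  assert (Ev2' : m2 th = cross v2 (dir (th + w))) by (coords; lra).
  clear Hle2 Ev2 HF. clearbody q.
  assert (Hsub : forall y, in_polygon vs y -> in_wedge w q th y).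
  { intros y Hy. apply in_wedge_cross; [exact Hs|]. split.
    - apply (polygon_halfplane n vs); auto. intros v Hv. rewrite Q1.
      specialize (Hle1 v Hv). lra.
    - replace (cross (vsub y q) (dir (th + w)))
        with (cross (vscale (-1) (dir (th + w))) (vsub y q)) by (coords; ring).
      apply (polygon_halfplane n vs); auto. intros v Hv.
      replace (cross (vscale (-1) (dir (th + w))) (vsub v q))
        with (cross (vsub v q) (dir (th + w))) by (coords; ring).
      rewrite Q2. specialize (Hle2' v Hv). lra. }
  set (s := dot (dir phi) (vsub x q)).
  assert (Exq : vsub x q = vscale s (dir phi)).
  { unfold s. clear - Q3 Hphi. set (z := vsub x q) in *. clearbody z.
    destruct z as [z1 z2], (dir phi) as [d1 d2]. coords. f_equal.
    - transitivity (z1 * (d1 * d1 + d2 * d2) + d2 * (d1 * z2 - d2 * z1));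
        [rewrite Hphi, Q3|]; ring.
    - transitivity (z2 * (d1 * d1 + d2 * d2) - d1 * (d1 * z2 - d2 * z1));
        [rewrite Hphi, Q3|]; ring. }
  (* Both [s * dir phi] and [dir phi] lie in the cone of the two rays. For [s < 0] this would make
     [dir phi] parallel to both rays, contradicting [sin w > 0]. *)
  assert (Hs0 : 0 <= s).
  { destruct (proj1 (in_wedge_cross w q th x Hs) (Hsub x Hx)) as [W1 W2].
    rewrite Exq in W1, W2.
    assert (W1' : 0 <= s * cross (dir th) (dir phi)) by (coords; lra).
    assert (W2' : 0 <= s * cross (dir phi) (dir (th + w))) by (coords; lra).
    destruct (Rle_lt_dec 0 s) as [|Hneg]; [assumption|exfalso].
    assert (Z1 : cross (dir th) (dir phi) = 0) by nra.
    assert (Z2 : cross (dir phi) (dir (th + w)) = 0) by nra.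
    assert (E : cross (dir th) (dir (th + w)) * dot (dir phi) (dir phi) =
      cross (dir th) (dir phi) * dot (dir phi) (dir (th + w))
      + cross (dir phi) (dir (th + w)) * dot (dir th) (dir phi)) by (coords; ring).
    rewrite Z1, Z2, Hc, Hphi in E. lra. }
  exists q, th. split; [exact Hsub|]. split; [|split; [|split]].
  - exists v1. split; [now apply (vertex_in_polygon n)|].
    destruct (Hsub v1) as (a & b & Ha & Hb & E); [now apply (vertex_in_polygon n)|].
    exists a; split; [exact Ha|].
    assert (Z : b * sin w = 0).
    { rewrite <- Hc. transitivity (cross (dir th) (vsub v1 q)); [rewrite E; coords; ring|].
      rewrite Q1; lra. }
    apply Rmult_integral in Z as [Z|Z]; [|lra]. rewrite E, Z. coords; f_equal; ring.
  - exists v2. split; [now apply (vertex_in_polygon n)|].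
    destruct (Hsub v2) as (a & b & Ha & Hb & E); [now apply (vertex_in_polygon n)|].
    exists b; split; [exact Hb|].
    assert (Z : a * sin w = 0).
    { rewrite <- Hc. transitivity (cross (vsub v2 q) (dir (th + w))); [rewrite E; coords; ring|].
      rewrite Q2; lra. }
    apply Rmult_integral in Z as [Z|Z]; [|lra]. rewrite E, Z. coords; f_equal; ring.
  - exists (- s / rho). cbn [fst snd]. rewrite Ed.
    destruct x, q, (dir phi). coords. injection Exq; intros.
    f_equal; field_simplify; lra.
  - exists (s / rho). split; [now apply Rle_mult_inv_pos|]. cbn [snd].
    replace (vadd q (vscale (s / rho) d)) with x; [exact Hx|]. rewrite Ed.
    destruct x, q, (dir phi). coords. injection Exq; intros.
    f_equal; field_simplify; lra.
Qed.

(** * The strategy and what it reads from the history *)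

Definition history : Type := list (dline * outcome).

Definition contacts (e : dline * outcome) : list point :=
  match snd e with Some (_, _, p1, p2) => [p1; p2] | None => [] end.

Definition known (h : history) : list point := flat_map contacts h.

Definition settled (w : R) (h : history) (a b : point) : Prop :=
  exists L q th p1 p2, In (L, Some (q, th, p1, p2)) h /\ wedge_left_of w q th a b.

(** A directed edge of the hull of the known vertices that no received wedge certifies. While only
    two vertices are known, both orientations are candidates. *)
Definition open_pair (w : R) (h : history) (a b : point) : Prop :=
  In a (known h) /\ In b (known h) /\ a <> b /\
  (forall x, In x (known h) -> 0 <= cross (vsub b a) (vsub x a)) /\
  ~ settled w h a b.

(** The pair is picked by classical choice; its defining condition mentions only [w] and the
    history, never the polygon. The first direction [(1, 0)] is arbitrary: going through [p] already
    guarantees a hit. *)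
Definition edge_probing (w : R) : strategy := fun p _ _ h =>
  match h with
  | [] => Probe (p, (1, 0))
  | _ =>
      match excluded_middle_informative (exists e, open_pair w h (fst e) (snd e)) with
      | left H =>
          let e := proj1_sig (constructive_indefinite_description _ H) in
          Probe (fst e, vsub (snd e) (fst e))
      | right _ => Answer (known h)
      end
  end.

Lemma edge_probing_cases (w : R) (p c : point) (r : R) (h : history) :
  h <> [] ->
  (exists a b, open_pair w h a b /\ edge_probing w p c r h = Probe (a, vsub b a)) \/
  ((forall a b, ~ open_pair w h a b) /\ edge_probing w p c r h = Answer (known h)).
Proof.
  intros Hne. destruct h as [|e0 h']; [contradiction|]. unfold edge_probing.
  destruct (excluded_middle_informative _) as [H|H].
  - left. destruct (constructive_indefinite_description _ H) as [[a b] He].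
    exists a, b. split; [exact He|reflexivity].
  - right. split; [|reflexivity]. intros a b Hab. apply H. now exists (a, b).
Qed.

Lemma known_app (h h' : history) : known (h ++ h') = known h ++ known h'.
Proof. apply flat_map_app. Qed.

Definition consistent (w : R) (vs : list point) (h : history) : Prop :=
  forall L o, In (L, o) h -> probe_answer w vs L o.

Lemma settled_polygon_left (w : R) (vs : list point) (h : history) (a b x : point) :
  consistent w vs h -> settled w h a b -> in_polygon vs x ->
  0 <= cross (vsub b a) (vsub x a).
Proof.
  intros Hcons (L & q & th & p1 & p2 & Hin & Hl) Hx.
  apply Hl. destruct (Hcons _ _ Hin) as ((Hsub & _) & _). now apply Hsub.
Qed.

(** * Open pairs exist while a vertex is unknown *)

Lemma left_pair_next (n : nat) (vs : list point) (i : nat) (b : point) :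
  convex_polygon n vs -> (i < n)%nat -> In b vs -> b <> vtx vs i ->
  0 <= cross (vsub b (vtx vs i)) (vsub (vtx vs (S i)) (vtx vs i)) ->
  b = vtx vs (S i).
Proof.
  intros Hconv Hi Hb Hne Hleft. pose proof Hconv as (_ & Hl & _).
  apply in_vertices in Hb as (j & Hj & ->). rewrite Hl in Hj.
  destruct (next_vertex n vs i j Hconv Hi Hj) as [E|[E|H]]; [contradiction|exact E|].
  coords; lra.
Qed.

(** The gift-wrapping step. Seen from [a], all other points lie in an open half-plane, where turning
    clockwise is transitive and an extreme point exists. *)
Lemma rightmost_exists (l : list point) (a e : point) :
  (forall x, In x l -> x <> a -> 0 < cross e (vsub x a)) ->
  (exists x, In x l /\ x <> a) ->
  exists b, In b l /\ b <> a /\ forall x, In x l -> 0 <= cross (vsub b a) (vsub x a).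
Proof.
  assert (Hself : forall u, cross (vsub u a) (vsub u a) = 0) by (intros; coords; ring).
  assert (Hbase : forall u, cross (vsub u a) (vsub a a) = 0) by (intros; coords; ring).
  induction l as [|y l IH]; intros Hpos (x0 & Hx0 & Hne0); [contradiction|].
  destruct (classic (exists x, In x l /\ x <> a)) as [Hl|Hl].
  - destruct IH as (b & Hb & Hba & Hmin);
      [intros x Hx; apply Hpos; now right|exact Hl|].
    destruct (Rle_lt_dec 0 (cross (vsub b a) (vsub y a))) as [C|C].
    + exists b. split; [now right|]. split; [exact Hba|].
      intros x [<-|Hx]; auto.
    + exists y. assert (Hya : y <> a) by (intros ->; rewrite Hbase in C; lra).
      split; [now left|]. split; [exact Hya|].
      intros x [<-|Hx]; [rewrite Hself; lra|].
      destruct (classic (x = a)) as [->|Hxa]; [rewrite Hbase; lra|].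
      pose proof (Hpos y (or_introl eq_refl) Hya) as Py.
      pose proof (Hpos b (or_intror Hb) Hba) as Pb.
      pose proof (Hpos x (or_intror Hx) Hxa) as Px.
      specialize (Hmin x Hx).
      (* The three-term identity between cross products gives transitivity: [x] is weakly left of
         [ab] and [y] strictly right of it, so [x] is left of [ay]. *)
      assert (E : cross e (vsub b a) * cross (vsub y a) (vsub x a) =
        cross e (vsub y a) * cross (vsub b a) (vsub x a)
        - cross e (vsub x a) * cross (vsub b a) (vsub y a)) by (coords; ring).
      nra.
  - assert (Hla : forall x, In x l -> x = a)
      by (intros x Hx; apply NNPP; intros Hxa; apply Hl; now exists x).
    destruct Hx0 as [->|Hx0]; [|exfalso; auto].
    exists x0. split; [now left|]. split; [exact Hne0|].
    intros x [<-|Hx]; [rewrite Hself; lra|]. rewrite (Hla x Hx), Hbase. lra.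
Qed.

(** Otherwise membership in [l] would pass from each vertex to the next, around the whole cycle. *)
Lemma vertex_gap (n : nat) (vs l : list point) (x v : point) :
  convex_polygon n vs -> In x l -> In x vs -> In v vs -> ~ In v l ->
  exists i, (i < n)%nat /\ In (vtx vs i) l /\ ~ In (vtx vs (S i)) l.
Proof.
  intros Hconv Hxl Hx Hv Hvl. pose proof Hconv as (Hn & Hl & _).
  apply NNPP; intros Hno.
  apply in_vertices in Hx as (i & Hi & ->). apply in_vertices in Hv as (j & Hj & ->).
  rewrite Hl in Hi, Hj.
  assert (Hall : forall k, In (vtx vs (i + k)) l).
  { induction k as [|k IH]; [now rewrite Nat.add_0_r|].
    rewrite <- plus_n_Sm. apply NNPP; intros Hc. apply Hno.
    exists ((i + k) mod n). split; [apply Nat.mod_upper_bound; lia|].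
    rewrite <- Hl, vtx_mod. split; [exact IH|].
    rewrite <- (vtx_mod vs (S ((i + k) mod length vs))).
    rewrite <- Nat.add_1_l, Nat.Div0.add_mod_idemp_r, vtx_mod. exact Hc. }
  (* Walking [j + n - i] steps from [i] ends at [j] modulo [n]; the summand [n] keeps the
     subtraction on [nat] from truncating. *)
  apply Hvl. specialize (Hall (j + n - i)%nat).
  replace (i + (j + n - i))%nat with (j + 1 * n)%nat in Hall by lia.
  revert Hall. unfold vtx. now rewrite Hl, Nat.Div0.mod_add.
Qed.

(** Take a known vertex [v_i] whose successor is unknown and let [b] be the rightmost known vertex
    seen from it. If the pair were settled, the successor too would lie to its left, which forces
    [b] to be that successor. *)
Lemma open_pair_exists (n : nat) (vs : list point) (w : R) (h : history) (x y v : point) :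
  convex_polygon n vs -> consistent w vs h -> incl (known h) vs ->
  In x (known h) -> In y (known h) -> x <> y ->
  In v vs -> ~ In v (known h) ->
  exists a b, open_pair w h a b.
Proof.
  intros Hconv Hcons Hincl Hx Hy Hxy Hv Hnv. pose proof Hconv as (_ & Hl & _).
  destruct (vertex_gap n vs (known h) x v) as (i & Hi & Ha & HS); auto.
  destruct (rightmost_exists (known h) (vtx vs i) (vsub (vtx vs (S i)) (vtx vs i)))
    as (b & Hb & Hba & Hmin).
  - intros z Hz Hza. pose proof (Hincl z Hz) as Hzv.
    apply in_vertices in Hzv as (j & Hj & E). rewrite Hl in Hj.
    destruct (next_vertex n vs i j Hconv Hi Hj) as [E'|[E'|H]].
    + congruence.
    + exfalso; apply HS; congruence.
    + now rewrite E.
  - destruct (classic (x = vtx vs i)) as [E|E]; [exists y|exists x]; split; auto; congruence.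
  - exists (vtx vs i), b. repeat split; auto.
    intros Hset. apply HS. rewrite <- (left_pair_next n vs i b); auto.
    apply (settled_polygon_left w vs h); auto.
    apply (vertex_in_polygon n); auto. now apply (vtx_in n).
Qed.

(* [K] collects vertices found and [V] the initial vertices of edges found. *)
Record progress (n : nat) (vs : list point) (w : R) (h : history) (m : nat) : Prop := {
  progress_consistent : consistent w vs h;
  progress_known : incl (known h) vs;
  progress_two : exists x y, In x (known h) /\ In y (known h) /\ x <> y;
  progress_count : exists K V, NoDup K /\ NoDup V /\ incl K (known h) /\ incl V vs /\
    (forall a, In a V -> exists b, In b vs /\ b <> a /\ settled w h a b) /\
    (m <= length K + length V)%nat
}.

(** * Counting the vertices and edges found *)

Lemma progress_complete (n : nat) (vs : list point) (w : R) (h : history) (m : nat) :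
  convex_polygon n vs -> progress n vs w h m -> (forall a b, ~ open_pair w h a b) ->
  forall x, In x (known h) <-> In x vs.
Proof.
  intros Hconv [Hcons Hincl (y & z & Hy & Hz & Hyz) _] Hno x. split; [apply Hincl|].
  intros Hx. apply NNPP; intros Hn.
  destruct (open_pair_exists n vs w h y z x) as (a & b & Hab); auto. now apply (Hno a b).
Qed.

(** Both [b] and [b'] must be the successor of [a]; so an edge may be counted by its initial
    vertex. *)
Lemma settled_unique (n : nat) (vs : list point) (w : R) (h : history) (a b b' : point) :
  convex_polygon n vs -> consistent w vs h ->
  In a vs -> In b vs -> In b' vs -> b <> a -> b' <> a ->
  settled w h a b ->
  (forall x, In x vs -> 0 <= cross (vsub b' a) (vsub x a)) -> b' = b.
Proof.
  intros Hconv Hcons Ha Hb Hb' Hne Hne' Hset Hleft. pose proof Hconv as (_ & Hl & _).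
  apply in_vertices in Ha as (i & Hi & ->). rewrite Hl in Hi.
  pose proof (vtx_in n vs (S i) Hconv) as HS.
  transitivity (vtx vs (S i)); [|symmetry]; apply (left_pair_next n); auto.
  apply (settled_polygon_left w vs h); auto. now apply (vertex_in_polygon n).
Qed.

(** [K] and [V] are duplicate-free lists of vertices, each of length at most [n]. A total of [2 * n]
    makes both exhaustive, so the edge leaving [a] is settled already. *)
Lemma progress_full (n : nat) (vs : list point) (w : R) (h : history) (m : nat) (a b : point) :
  convex_polygon n vs -> progress n vs w h m -> (2 * n <= m)%nat -> ~ open_pair w h a b.
Proof.
  intros Hconv [Hcons Hincl _ (K & V & NK & NV & IK & IV & HV & Hm)] Hle
    (Ha & Hb & Hab & Hleft & Hns).
  pose proof Hconv as (_ & Hl & _).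
  assert (IKv : incl K vs) by (intros x Hx; auto).
  pose proof (NoDup_incl_length NK IKv) as LK. pose proof (NoDup_incl_length NV IV) as LV.
  assert (CK : incl vs K) by (apply NoDup_length_incl; auto; lia).
  assert (CV : incl vs V) by (apply NoDup_length_incl; auto; lia).
  destruct (HV a (CV a (Hincl a Ha))) as (b' & Hb' & Hne & Hset).
  apply Hns. rewrite (settled_unique n vs w h a b' b); auto.
Qed.

Lemma settled_app (w : R) (h h' : history) (a b : point) :
  settled w h a b -> settled w (h ++ h') a b.
Proof.
  intros (L & q & th & p1 & p2 & Hin & H). exists L, q, th, p1, p2.
  split; [apply in_or_app; now left|exact H].
Qed.

Lemma consistent_snoc (w : R) (vs : list point) (h : history) (L : dline) (o : outcome) :
  consistent w vs h -> probe_answer w vs L o -> consistent w vs (h ++ [(L, o)]).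
Proof.
  intros Hcons Ho L' o' Hin. apply in_app_or in Hin as [Hin|[E|[]]]; [now apply Hcons|].
  now injection E as <- <-.
Qed.

Lemma progress_step (n : nat) (vs : list point) (w : R) (h : history) (m : nat)
    (a b q : point) (th : R) (p1 p2 : point) :
  0 < w <= PI / 2 -> convex_polygon n vs ->
  (forall i : nat, (i < n)%nat -> internal_angle vs i > w) ->
  progress n vs w h m -> open_pair w h a b ->
  probe_answer w vs (a, vsub b a) (Some (q, th, p1, p2)) ->
  progress n vs w (h ++ [((a, vsub b a), Some (q, th, p1, p2))]) (S m).
Proof.
  intros Hw Hconv Hang Hprog (Ha & Hb & Hab & Hleft & Hns) Hans.
  destruct Hprog as [Hcons Hincl (x & y & Hx & Hy & Hxy) (K & V & NK & NV & IK & IV & HV & Hm)].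
  destruct (probe_contacts n vs w _ q th p1 p2 Hw Hconv Hang Hans) as (Hp1 & Hp2 & _).
  set (L := (a, vsub b a)) in *. set (e := (L, Some (q, th, p1, p2))).
  assert (IK' : incl K (known (h ++ [e])))
    by (intros z Hz; rewrite known_app; apply in_or_app; left; auto).
  assert (HV' : forall z, In z V -> exists z', In z' vs /\ z' <> z /\ settled w (h ++ [e]) z z').
  { intros z Hz. destruct (HV z Hz) as (z' & ? & ? & ?).
    exists z'. repeat split; auto. now apply settled_app. }
  assert (Hcons' : consistent w vs (h ++ [e])) by now apply consistent_snoc.
  split.
  - exact Hcons'.
  - rewrite known_app. apply incl_app; [exact Hincl|].
    intros z Hz. destruct Hz as [<-|[<-|[]]]; assumption.
  - exists x, y. rewrite known_app. repeat split; auto; apply in_or_app; now left.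
  - assert (Hnew : cross (vsub b a) (vsub p1 a) < 0 -> exists K V, NoDup K /\ NoDup V /\
      incl K (known (h ++ [e])) /\ incl V vs /\
      (forall z, In z V -> exists z', In z' vs /\ z' <> z /\ settled w (h ++ [e]) z z') /\
      (S m <= length K + length V)%nat).
    { intros Hneg. exists (p1 :: K), V. split.
      - constructor; [|exact NK]. intros Hin. specialize (Hleft p1 (IK p1 Hin)). lra.
      - split; [exact NV|]. split; [|split; [exact IV|split; [exact HV'|simpl; lia]]].
        intros z [<-|Hz]; [|auto]. rewrite known_app. apply in_or_app; right; now left. }
    (* Two of the cases put [p1] strictly right of [ab], where no known vertex lies. In the
       remaining one [a] is new in [V], since by uniqueness an edge counted earlier from [a] would
       have settled the open pair. *)
    destruct (probe_through_pair n vs w a b q th p1 p2) as [[H _]|[[H _]|[_ H]]]; auto.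
    exists K, (a :: V). split; [exact NK|]. split; [|split; [exact IK'|split; [|split]]].
    + constructor; [|exact NV]. intros Hin. destruct (HV a Hin) as (b' & Hb' & Hne & Hset).
      apply Hns. rewrite (settled_unique n vs w h a b' b); auto.
      intros z Hz. apply H. destruct Hans as ((Hsub & _) & _).
      apply Hsub. now apply (vertex_in_polygon n).
    + intros z [<-|Hz]; auto.
    + intros z [<-|Hz]; [|now apply HV']. exists b. repeat split; auto.
      exists L, q, th, p1, p2. split; [apply in_or_app; right; now left|exact H].
    + simpl; lia.
Qed.

(* After one probe both known vertices lie on the probed line, so the second probe either
   finds two new vertices, or an edge and a new vertex. This saves one probe. *)
Lemma progress_second (n : nat) (vs : list point) (w : R) (L0 : dline) (o : outcome)
    (a b q : point) (th : R) (p1 p2 : point) :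
  0 < w <= PI / 2 -> convex_polygon n vs ->
  (forall i : nat, (i < n)%nat -> internal_angle vs i > w) ->
  progress n vs w [(L0, o)] 2 -> open_pair w [(L0, o)] a b ->
  probe_answer w vs (a, vsub b a) (Some (q, th, p1, p2)) ->
  progress n vs w [(L0, o); ((a, vsub b a), Some (q, th, p1, p2))] 4.
Proof.
  intros Hw Hconv Hang Hprog Hopen Hans.
  pose proof (progress_step n vs w _ 2 a b q th p1 p2 Hw Hconv Hang Hprog Hopen Hans)
    as [Hcons' Hincl' Htwo' _].
  split; [exact Hcons'|exact Hincl'|exact Htwo'|].
  destruct Hopen as (Ha & Hb & Hab & _). pose proof (progress_known _ _ _ _ _ Hprog) as Hincl.
  pose proof (Hincl a Ha) as Hav. pose proof (Hincl b Hb) as Hbv.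
  set (L := (a, vsub b a)) in *. set (e := (L, Some (q, th, p1, p2))) in *.
  assert (Hin : forall z, In z (known [(L0, o)]) -> In z (known [(L0, o); e]))
    by (intros z Hz; change (In z (known ([(L0, o)] ++ [e]))); rewrite known_app;
        apply in_or_app; now left).
  assert (Hin' : forall z, z = p1 \/ z = p2 -> In z (known [(L0, o); e]))
    by (intros z Hz; change (In z (known ([(L0, o)] ++ [e]))); rewrite known_app;
        apply in_or_app; right; destruct Hz as [-> | ->]; simpl; auto).
  apply Hin in Ha, Hb.
  assert (Haa : cross (vsub b a) (vsub a a) = 0) by (coords; ring).
  assert (Hba : cross (vsub b a) (vsub b a) = 0) by (coords; ring).
  assert (Hset : forall c d, wedge_left_of w q th c d -> settled w [(L0, o); e] c d)
    by (intros c d H; exists L, q, th, p1, p2; split; [right; now left|exact H]).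
  assert (Hnd : forall p, cross (vsub b a) (vsub p a) <> 0 -> NoDup [p; a; b]).
  { intros p Hp. repeat constructor; simpl; try tauto.
    - intros [->|[->|[]]]; contradiction.
    - intros [->|[]]; contradiction. }
  destruct (probe_through_pair n vs w a b q th p1 p2) as [[H1 H2]|[[H H2]|[H H1]]]; auto.
  - exists [p1; p2; a; b], []. split; [|split; [constructor|split; [|split; [|split]]]].
    + constructor; [|apply Hnd; lra].
      intros [->|[->|[->|[]]]]; lra.
    + intros z [<-|[<-|[<-|[<-|[]]]]]; auto.
    + intros z [].
    + intros z [].
    + simpl; lia.
  - exists [p2; a; b], [a]. split; [apply Hnd; lra|].
    split; [repeat constructor; simpl; tauto|split; [|split; [|split]]].
    + intros z [<-|[<-|[<-|[]]]]; auto.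
    + intros z [<-|[]]; auto.
    + intros z [<-|[]]. exists b; auto.
    + simpl; lia.
  (* The ray [th + w] runs along the line, so the edge found is directed against the probe and
     starts at [b]. *)
  - exists [p1; a; b], [b]. split; [apply Hnd; lra|].
    split; [repeat constructor; simpl; tauto|split; [|split; [|split]]].
    + intros z [<-|[<-|[<-|[]]]]; auto.
    + intros z [<-|[]]; auto.
    + intros z [<-|[]]. exists a; auto.
    + simpl; lia.
Qed.

(** * Running the strategy within the budget *)

Lemma vsub_neq_0 (a b : point) : a <> b -> vsub b a <> (0, 0).
Proof.
  destruct a, b; intros H E; coords. injection E; intros. apply H; f_equal; lra.
Qed.

Lemma probe_hits (n : nat) (vs : list point) (w : R) (L : dline) :
  0 < w <= PI / 2 -> convex_polygon n vs -> in_polygon vs (fst L) -> snd L <> (0, 0) ->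
  ~ probe_answer w vs L None.
Proof. intros Hw Hconv HL Hd H. apply H. now apply (valid_probe_exists n). Qed.

(** Each probe moves one unit from the budget [k] to the count [m]. Once [k = 0] the count has
    reached [2 * n], and [progress_full] excludes a further probe. *)
Lemma succeeds_of_progress (n : nat) (vs : list point) (w : R) (p c : point) (r : R)
    (k : nat) (h : history) (m : nat) :
  0 < w <= PI / 2 -> convex_polygon n vs ->
  (forall i : nat, (i < n)%nat -> internal_angle vs i > w) ->
  h <> [] -> progress n vs w h m -> (2 * n <= m + k)%nat ->
  succeeds w vs (edge_probing w) p c r k h.
Proof.
  intros Hw Hconv Hang. revert h m. induction k as [|k IH]; intros h m Hne Hprog Hle;
    simpl; destruct (edge_probing_cases w p c r h Hne) as [(a & b & Hab & ->)|[Hno ->]];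
    try now apply (progress_complete n vs w h m).
  - exfalso. revert Hab. apply (progress_full n vs w h m); auto; lia.
  - pose proof Hab as (Ha & _ & Hneq & _).
    assert (Hd : vsub b a <> (0, 0)) by now apply vsub_neq_0.
    split; [exact Hd|]. intros [[[[q th] p1] p2]|] Hans.
    + apply (IH _ (S m)); [destruct h; discriminate| |lia]. now apply progress_step.
    + exfalso. revert Hans. apply (probe_hits n); auto.
      apply (vertex_in_polygon n); auto. now apply (progress_known _ _ _ _ _ Hprog).
Qed.

Theorem theorem4p1 (omega : R) (Homega : 0 < omega <= PI / 2) :
  exists S : strategy,
    forall (n : nat) (vs : list point) (p c : point) (r : R),
      convex_polygon n vs ->
      (forall i : nat, (i < n)%nat -> internal_angle vs i > omega) ->
      in_polygon vs p ->
      (forall x, in_polygon vs x -> pdist x c <= r) ->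
      succeeds omega vs S p c r (2 * n - 2) nil.
Proof.
  exists (edge_probing omega). intros n vs p c r Hconv Hang Hp _.
  assert (Hn : (3 <= n)%nat) by apply Hconv.
  (* The first two probes are split off; they bring the count to 4, leaving [2 * n - 4] probes for
     the remaining [2 * n - 4] units. *)
  replace (2 * n - 2)%nat with (S (S (2 * n - 4))) by lia.
  set (k := (2 * n - 4)%nat). cbn [succeeds edge_probing app snd].
  assert (H10 : (1, 0) <> (0, 0)) by (intros E; injection E; lra).
  split; [exact H10|]. intros [[[[q th] p1] p2]|] Hans;
    [|exfalso; revert Hans; now apply (probe_hits n)].
  set (o := Some (q, th, p1, p2)) in *.
  assert (Hprog : progress n vs omega [((p, (1, 0)), o)] 2).
  { destruct (probe_contacts n vs omega _ q th p1 p2 Homega Hconv Hang Hans) as (H1 & H2 & _).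
    pose proof (probe_contacts_neq n vs omega _ q th p1 p2 Homega Hconv Hang Hans) as H12.
    split.
    - intros L' o' [E|[]]. now injection E as <- <-.
    - intros z [<-|[<-|[]]]; assumption.
    - exists p1, p2. simpl; auto.
    - exists [p1; p2], []. split; [|split; [constructor|]].
      + repeat constructor; simpl; intuition congruence.
      + split; [intros z Hz; exact Hz|]. split; [intros z []|]. split; [intros z []|simpl; lia]. }
  change (succeeds omega vs (edge_probing omega) p c r (S k) [((p, (1, 0)), o)]).
  cbn [succeeds].
  destruct (edge_probing_cases omega p c r [((p, (1, 0)), o)])
    as [(a & b & Hab & ->)|[Hno ->]];
    [discriminate| |now apply (progress_complete n vs omega _ 2)].
  pose proof Hab as (Ha & _ & Hneq & _).
  assert (Hd : vsub b a <> (0, 0)) by now apply vsub_neq_0.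
  split; [exact Hd|]. intros [[[[q' th'] p1'] p2']|] Hans'.
  - apply (succeeds_of_progress n vs omega p c r k _ 4); auto; [discriminate| |unfold k; lia].
    now apply progress_second.
  - exfalso. revert Hans'. apply (probe_hits n); auto.
    apply (vertex_in_polygon n); auto. now apply (progress_known _ _ _ _ _ Hprog).
Qed.
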